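(* Let $r_1,\tau_0$ be constants with $r_1\neq0$, and put $R_1=n+\frac{2\tau_0^2n}{r_1^2}$. Let $r\ge R_1>n$. The geodesics for metrics of self-dual Taub-NUT type with constant $\theta$, $\varphi$ and conditions $$\lim_{r\to R_1}t=t_1,\quad \lim_{r\to R_1}\tau=\tau_1,\quad \lim_{r\to R_1}\frac{r-n}{r+n}\frac{d\tau}{dt}=\tau_0,\quad \lim_{r\to R_1}\left[\frac{r+n}{r-n}\left(\frac{dr}{dt}\right)^2+\frac{2\tau_0^2n}{r-n}\right]=r_1^2$$ satisfy $$t(r)=t_1+\frac{\epsilon}{r_1}\left[\sqrt{r-R_1}\sqrt{r+n}+(n+R_1)\ln\left(\sqrt{r-R_1}+\sqrt{r+n}\right)\right],$$ $$\tau(r)=\tau_1+\frac{\epsilon\tau_0}{r_1}\left[(5n+R_1)\ln\left(\sqrt{r-R_1}+\sqrt{r+n}\right)+\frac{2(2n)^{3/2}}{\sqrt{R_1-n}}\arctan\left(\frac{\sqrt{2n}\sqrt{r-R_1}}{\sqrt{R_1-n}\sqrt{r+n}}\right)+\sqrt{r-R_1}\sqrt{r+n}\right],$$ where $\epsilon=\pm1$.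
   Context: The metric of self-dual Taub-NUT type with parameter $n$ is $$ds^2=\frac{r-n}{r+n}(d\tau+2n\cos\theta\, d\varphi)^2+(r^2-n^2)(d\theta^2+\sin^2\theta\, d\varphi^2)+\frac{r+n}{r-n}dr^2$$ in coordinates $(\tau,r,\theta,\varphi)$. Geodesics are solutions of the geodesic equations of this metric with parameter $t$; along them $t$ and $\tau$ are expressed as functions of $r$. Here $t_1$ and $\tau_1$ are constants.
   Formalization: In both formulas the argument of ln is divided by its value √(R₁+n) at r=R₁; as printed, the right-hand sides do not tend to t₁ and τ₁ as r→R₁ unless R₁+n=1. Also sin θ≠0 is assumed, so that the metric is nondegenerate. *)

(* Defs.v *)
From HB Require Import structures.
From mathcomp Require Import all_boot all_order all_algebra.
From mathcomp Require Import all_classical all_reals all_analysis.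
Set Implicit Arguments.
Unset Strict Implicit.
Unset Printing Implicit Defensive.
Import Order.TTheory GRing.Theory Num.Theory.
Import numFieldNormedType.Exports.
Local Open Scope classical_set_scope.
Local Open Scope ring_scope.

Section Geodesics.
Context {R : realType} {m : nat}.
Implicit Types (g : 'rV[R]_m.+1 -> 'M[R]_m.+1) (x : 'rV[R]_m.+1).

Definition partial (i : 'I_m.+1) (f : 'rV[R]_m.+1 -> R) x : R :=
  'D_(delta_mx 0 i) f x.

(* Gamma^k_(ij); meaningful where g is invertible, since invmx g = g elsewhere. *)
Definition christoffel g x (k i j : 'I_m.+1) : R :=
  2^-1 * \sum_l invmx (g x) k l *
    (partial i (fun y => g y j l) x + partial j (fun y => g y i l) x
     - partial l (fun y => g y i j) x).

Definition curve_coord (c : R -> 'rV[R]_m.+1) (k : 'I_m.+1) : R -> R :=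
  fun s => c s 0 k.

(* The derivatives are two-sided: at an endpoint of I that belongs to I the
   curve is thus required to extend as a differentiable curve. *)
Definition geodesic g (I : interval R) (c : R -> 'rV[R]_m.+1) : Prop :=
  forall s, s \in I -> forall k,
    [/\ \forall u \near s, derivable (curve_coord c k) u 1,
        derivable (derive1 (curve_coord c k)) s 1
      & derive1n 2 (curve_coord c k) s +
        \sum_i \sum_j christoffel g (c s) k i j *
          derive1 (curve_coord c i) s * derive1 (curve_coord c j) s = 0].

End Geodesics.

Definition itau : 'I_4 := @Ordinal 4 0 isT.
Definition irad : 'I_4 := @Ordinal 4 1 isT.
Definition itheta : 'I_4 := @Ordinal 4 2 isT.
Definition iphi : 'I_4 := @Ordinal 4 3 isT.

Section TaubNUT.
Context {R : realType}.

(* The coordinate 1-form dx^i, as a row of components. *)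
Definition dform (i : 'I_4) : 'rV[R]_4 := delta_mx 0 i.

(* The square of a 1-form, as a symmetric bilinear form. *)
Definition sqform (w : 'rV[R]_4) : 'M[R]_4 := w^T *m w.

Definition taub_nut (n : R) (x : 'rV[R]_4) : 'M[R]_4 :=
  let r := x 0 irad in
  let theta := x 0 itheta in
  ((r - n) / (r + n)) *: sqform (dform itau + (2 * n * cos theta) *: dform iphi)
  + (r ^+ 2 - n ^+ 2) *:
      (sqform (dform itheta) + (sin theta ^+ 2) *: sqform (dform iphi))
  + ((r + n) / (r - n)) *: sqform (dform irad).

End TaubNUT.

(* Main.v *)
Require Import Defs.
From HB Require Import structures.
From mathcomp Require Import all_boot all_order all_algebra.
From mathcomp Require Import all_classical all_reals all_analysis.
From mathcomp Require Import ring lra.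
Set Implicit Arguments.
Unset Strict Implicit.
Unset Printing Implicit Defensive.
Import Order.TTheory GRing.Theory Num.Theory.
Import numFieldNormedType.Exports.
Local Open Scope classical_set_scope.
Local Open Scope ring_scope.

(** With theta and phi constant, only the block gtt dtau^2 + grr dr^2 of the
    metric acts, where gtt = (r - n) / (r + n) and grr = 1 / gtt depend on r
    alone. The geodesic equations then have two first integrals: the momentum
    gtt tau' of the cyclic coordinate tau, and the squared speed
    gtt tau'^2 + grr r'^2 ([radial_geodesic_eqs], [radial_first_integrals]).
    The limits at R1 give the momentum the value tau0 and the squared speed
    the value r1^2 + tau0^2, and eliminating tau' leaves

      r'^2 = r1^2 (r - R1) / (r + n),     tau' = tau0 (r + n) / (r - n).

    Since the parameter t is a function of r along the curve, r is injective
    on I, hence monotone, so that r' = eps r1 sqrt ((r - R1) / (r + n)) with a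
    single sign eps ([radial_speed_sign]). Consequently

      dt/dr   = (eps / r1) sqrt ((r + n) / (r - R1)),
      dtau/dr = (eps tau0 / r1) (r + n) / (r - n) sqrt ((r + n) / (r - R1)),

    whose primitives vanishing at R1 are [prim_t] and [prim_tau]; both are
    differentiable for r > R1 and continuous at R1.

    The delicate point is R1 itself, where r' vanishes and the primitives have
    infinite slope. [quadrature] therefore compares derivatives only where
    r > R1, fixes the constant by the limit at R1, and reaches an endpoint with
    r = R1 by continuity. Likewise, derivatives at the points of I are two-sided
    even at an endpoint, while the hypotheses speak of I only;
    [closed_cvg_itv] bridges the two. *)

(** * Calculus along an interval *)

Section Interval.
Context {R : realType}.
Implicit Types (I : interval R) (f : R -> R).

(** A property that holds only at the points of I still passes to a limit
    taken along the full punctured neighbourhood of s, because I, having a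
    second point s' and being convex, accumulates at s. This is how two-sided
    derivatives at an endpoint of I are read off from values on I alone. *)
Lemma closed_cvg_itv I s s' (A : set R) (u : R -> R) l :
  s \in I -> s' \in I -> s != s' -> closed A ->
  (forall h, h != 0 -> h + s \in I -> A (u h)) ->
  u h @[h --> 0^'] --> l -> A l.
Proof.
move=> sI s'I ss' cA uA ul.
pose F := within [set h | h + s \in I] (0^' : set_system R).
have FF : ProperFilter F.
  split; last exact: within_filter.
  rewrite /F /within /= => /nbhs_ballP[e /= e0 be].
  (* h = k (s' - s) with k <= 1 keeps h + s between s and s', hence in I,
     while k is small enough for h to lie in the given ball. *)
  pose d := `|s' - s|; have d0 : 0 < d by rewrite normr_gt0 subr_eq0 eq_sym.
  pose k := Num.min (e / 2) d / d.
  have k0 : 0 < k by rewrite divr_gt0// lt_min d0 divr_gt0.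
  have k1 : k <= 1 by rewrite ler_pdivrMr// mul1r ge_min lexx orbT.
  have kd : k * d < e.
    by rewrite /k divfK ?gt_eqF// gt_min gtr_pMr// invf_lt1 ?ltr1n.
  apply: (be (k * (s' - s))).
  - by rewrite /ball /= sub0r normrN normrM gtr0_norm.
  - by apply: mulf_neq0; rewrite ?(gt_eqF k0)// subr_eq0 eq_sym.
  - rewrite /=; have II := @interval_is_interval _ I.
    have [lt|gt|/eqP] := ltgtP s s'; last by rewrite (negbTE ss').
    + by apply: (II s s') => //=; nra.
    + by apply: (II s' s) => //=; nra.
apply: (@closed_cvg _ _ F _ u A cA); last first.
  by apply: cvg_trans ul; apply: cvg_app; exact: cvg_within.
rewrite /F /within /= near_withinE; near=> h => hI; apply: uA => //.
by near: h; exact: nbhs_dnbhs_neq.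
Unshelve. all: by end_near. Qed.

Lemma continuous_eq_itv I s s' f a :
  s \in I -> s' \in I -> s != s' -> {for s, continuous f} ->
  (forall u, u \in I -> u != s -> f u = a) -> f s = a.
Proof.
move=> sI s'I ss' fs fa.
apply: (closed_cvg_itv sI s'I ss' (A := [set a]) (u := fun h => f (h + s))).
- exact: closed_eq.
- by move=> h h0 hI; apply: fa => //; rewrite -subr_eq0 addrK.
- have -> : f s = f (0 + s) by rewrite add0r.
  apply: cvg_within_filter.
  apply: (@continuous_comp _ _ _ (fun h => h + s) f).
    by apply: cvgD; [exact: cvg_id|exact: cvg_cst].
  by rewrite add0r.
Qed.

Lemma derive1_cst_itv I s s' f a :
  s \in I -> s' \in I -> s != s' -> derivable f s 1 ->
  (forall u, u \in I -> f u = a) -> derive1 f s = 0.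
Proof.
move=> sI s'I ss' fs fa.
apply: (closed_cvg_itv sI s'I ss' (A := [set 0])
  (u := fun h => h^-1 *: (f (h *: 1 + s) - f s))); last first.
  by rewrite derive1E; exact: fs.
  by move=> h h0 hI /=; rewrite [h *: 1]mulr1 !fa// subrr scaler0.
exact: closed_eq.
Qed.

Lemma derive1_ge0_itv I s s' f :
  s \in I -> s' \in I -> s != s' -> derivable f s 1 ->
  {in I &, {homo f : x y / x < y}} -> 0 <= derive1 f s.
Proof.
move=> sI s'I ss' fs fI.
apply: (closed_cvg_itv sI s'I ss' (A := [set x | 0 <= x])
  (u := fun h => h^-1 *: (f (h *: 1 + s) - f s))); last first.
  by rewrite derive1E; exact: fs.
  move=> h h0 hI /=; rewrite [h *: 1]mulr1 [_ *: _]mulrC.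
  case: (ltgtP h 0) h0 => // h0 _.
    rewrite nmulr_lge0 ?invr_lt0// subr_le0 ltW// fI// -subr_gt0; lra.
  rewrite pmulr_lge0 ?invr_gt0// subr_ge0 ltW// fI// -subr_gt0; lra.
exact: closed_ge.
Qed.

Lemma derive1_eq0_cst_itv I f :
  (forall u, u \in I -> is_derive u 1 f 0) ->
  forall a b, a \in I -> b \in I -> f a = f b.
Proof.
move=> df; have main a b : a \in I -> b \in I -> a < b -> f a = f b.
  move=> aI bI ab.
  have sub x : x \in `[a, b] -> x \in I.
    by rewrite in_itv => /= ax; exact: (@interval_is_interval _ I a b).
  have df' x : x \in `]a, b[ -> is_derive x 1 f (cst 0 x).
    by move=> xab; apply: df; apply: sub; exact: subset_itv_oo_cc.
  have cf : {within `[a, b], continuous f}.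
    apply: derivable_within_continuous => x xab.
    by have [] := df _ (sub _ xab).
  have [x _ /eqP] := MVT ab df' cf.
  by rewrite mul0r subr_eq0 => /eqP.
move=> a b aI bI; case: (ltgtP a b) => [|ba|->//]; first exact: main.
by rewrite (main b a).
Qed.

End Interval.

(** * The geodesic equation with lowered index *)

Section LoweredGeodesics.
Context {R : realType} {m : nat}.
Implicit Types (g : 'rV[R]_m.+1 -> 'M[R]_m.+1) (x : 'rV[R]_m.+1).

(** Only the restriction of f to the i-th coordinate line through x matters,
    so that a metric coefficient can be differentiated in one coordinate with
    the others held fixed. *)
Lemma partial_line (f : 'rV[R]_m.+1 -> R) (phi : R -> R) i x :
  (forall h, f (h *: delta_mx 0 i + x) = phi (h + x 0 i)) ->
  partial i f x = derive1 phi (x 0 i).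
Proof.
move=> fE; have fx : f x = phi (x 0 i).
  by rewrite -[x in LHS]add0r -(scale0r (delta_mx 0 i)) fE add0r.
by rewrite /partial /derive /derive1; under eq_fun do rewrite /= fE fx.
Qed.

(** The Christoffel symbols of the first kind, with k the lowered index. *)
Definition christoffel1 g x (k i j : 'I_m.+1) : R :=
  2^-1 * (partial i (fun y => g y j k) x + partial j (fun y => g y i k) x
          - partial k (fun y => g y i j) x).

Lemma lower_christoffel g x k i j : g x \in unitmx ->
  \sum_l g x k l * christoffel g x l i j = christoffel1 g x k i j.
Proof.
move=> gU.
pose v : 'cV[R]_m.+1 := \col_l christoffel1 g x l i j.
have -> : christoffel1 g x k i j = (g x *m (invmx (g x) *m v)) k 0.
  by rewrite mulKVmx // mxE.
rewrite mxE; apply: eq_bigr => l _; congr (_ * _).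
rewrite mxE /christoffel mulr_sumr; apply: eq_bigr => p _.
by rewrite mxE /christoffel1 mulrCA.
Qed.

(** Contracting the geodesic equation with the metric removes its inverse:
    only first derivatives of the coefficients of g remain to be computed. *)
Lemma geodesic_lowered g I (c : R -> 'rV[R]_m.+1) s k :
  geodesic g I c -> s \in I -> g (c s) \in unitmx ->
  \sum_l g (c s) k l * derive1 (derive1 (curve_coord c l)) s +
  \sum_i \sum_j christoffel1 g (c s) k i j *
    derive1 (curve_coord c i) s * derive1 (curve_coord c j) s = 0.
Proof.
move=> geo sI gU.
have E : \sum_l g (c s) k l * (derive1 (derive1 (curve_coord c l)) s +
   \sum_i \sum_j christoffel g (c s) l i j *
        derive1 (curve_coord c i) s * derive1 (curve_coord c j) s) = 0.
  by apply: big1 => l _; have [_ _ ->] := geo s sI l; rewrite mulr0.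
rewrite -[RHS]E; under [RHS]eq_bigr do rewrite mulrDr.
rewrite big_split; congr (_ + _).
under [RHS]eq_bigr do rewrite mulr_sumr.
rewrite [RHS]exchange_big /=; apply: eq_bigr => i _.
under [RHS]eq_bigr do rewrite mulr_sumr.
rewrite [RHS]exchange_big /=; apply: eq_bigr => j _.
rewrite -lower_christoffel // !mulr_suml; apply: eq_bigr => l _.
by rewrite !mulrA.
Qed.

End LoweredGeodesics.

(** * The radial geodesic equations of the Taub-NUT metric *)

Section Metric.
Context {R : realType}.
Variable n : R.
Implicit Types x : 'rV[R]_4.

Lemma taub_nutE x i j : taub_nut n x i j =
  (x 0 irad - n) / (x 0 irad + n) *
    ((i == itau)%:R + 2 * n * cos (x 0 itheta) * (i == iphi)%:R) *
    ((j == itau)%:R + 2 * n * cos (x 0 itheta) * (j == iphi)%:R)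
  + (x 0 irad ^+ 2 - n ^+ 2) * ((i == itheta)%:R * (j == itheta)%:R
     + sin (x 0 itheta) ^+ 2 * ((i == iphi)%:R * (j == iphi)%:R))
  + (x 0 irad + n) / (x 0 irad - n) * ((i == irad)%:R * (j == irad)%:R).
Proof.
rewrite /taub_nut /sqform /dform !mxE !big_ord1 !mxE !eqxx /=; ring.
Qed.

Lemma big_ord4 (F : 'I_4 -> R) :
  \sum_i F i = F itau + F irad + F itheta + F iphi.
Proof.
rewrite !big_ord_recl big_ord0 addr0 !addrA.
by do !congr (_ + _); congr F; exact: val_inj.
Qed.

(** The metric is a triangular change of coframe away from a diagonal one, and
    sin theta != 0 keeps its last diagonal entry nonzero. *)
Lemma taub_nut_unit x : 0 < n -> n < x 0 irad -> sin (x 0 itheta) != 0 ->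
  taub_nut n x \in unitmx.
Proof.
move=> n0 nr st; rewrite -row_free_unit; apply/inj_row_free => v.
move=> /matrixP v0; have := (v0 0 itau, v0 0 irad, v0 0 itheta, v0 0 iphi).
rewrite !mxE !big_ord4 !taub_nutE /= !(mulr0, mulr1, add0r, addr0).
set A := (_ - _) / _; set B := (_ + _) / _; set C := _ - _.
have A0 : A != 0 by rewrite gt_eqF// divr_gt0//; lra.
have B0 : B != 0 by rewrite gt_eqF// divr_gt0//; lra.
have C0 : C != 0 by rewrite gt_eqF// /C; nra.
move=> [[[e0 e1] e2] e3].
have v1 : v 0 irad = 0 by apply: (mulIf B0); rewrite e1 mul0r.
have v2 : v 0 itheta = 0 by apply: (mulIf C0); rewrite e2 mul0r.
have v3 : v 0 iphi = 0.
  apply: (mulIf (mulf_neq0 C0 (expf_neq0 2 st))); rewrite mul0r.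
  (* Subtracting this multiple of the tau-column from the phi-column leaves
     (r^2 - n^2) sin^2 theta alone. *)
  have := congr2 (fun a b => b - 2 * n * cos (x 0 itheta) * a) e0 e3.
  by rewrite mulr0 subr0 => <-; ring.
have v4 : v 0 itau = 0.
  by apply: (mulIf A0); rewrite mul0r -[RHS]e0 v3; ring.
apply/rowP => j; rewrite mxE.
case: j => -[|[|[|[|//]]]] lj;
  [rewrite -[RHS]v4|rewrite -[RHS]v1|rewrite -[RHS]v2|rewrite -[RHS]v3];
  congr (v 0 _); exact: val_inj.
Qed.

(** tau is a cyclic coordinate. *)
Lemma partial_tau_taub_nut x i j :
  partial itau (fun y => taub_nut n y i j) x = 0.
Proof.
rewrite (@partial_line _ _ _ (cst (taub_nut n x i j))) ?derive1_cst // => h.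
by rewrite !taub_nutE !mxE /= mulr0 !add0r.
Qed.

Lemma partial_rad_taub_nut x i j (phi : R -> R) :
  (forall y : 'rV[R]_4, y 0 itheta = x 0 itheta ->
     taub_nut n y i j = phi (y 0 irad)) ->
  partial irad (fun y => taub_nut n y i j) x = derive1 phi (x 0 irad).
Proof.
move=> phiE; apply: partial_line => h.
by rewrite phiE !mxE /= ?mulr0 ?add0r ?mulr1.
Qed.

Definition gtt (r : R) := (r - n) / (r + n).
Definition grr (r : R) := (r + n) / (r - n).

Lemma partial_rad_gtt x :
  partial irad (fun y => taub_nut n y itau itau) x = derive1 gtt (x 0 irad).
Proof.
by apply: partial_rad_taub_nut => y _; rewrite taub_nutE /= /gtt; ring.
Qed.

Lemma partial_rad_grr x :
  partial irad (fun y => taub_nut n y irad irad) x = derive1 grr (x 0 irad).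
Proof.
by apply: partial_rad_taub_nut => y _; rewrite taub_nutE /= /grr; ring.
Qed.

Lemma partial_rad_gtr x i j : (i, j) = (itau, irad) \/ (i, j) = (irad, itau) ->
  partial irad (fun y => taub_nut n y i j) x = 0.
Proof.
move=> ij; rewrite (@partial_rad_taub_nut _ _ _ (cst 0)) ?derive1_cst // => y _.
by case: ij => -[-> ->]; rewrite taub_nutE /=; ring.
Qed.

Lemma christoffel1_tau x (G := christoffel1 (taub_nut n) x itau) :
  [/\ G itau itau = 0, G itau irad = 2^-1 * derive1 gtt (x 0 irad),
      G irad itau = 2^-1 * derive1 gtt (x 0 irad) & G irad irad = 0].
Proof.
rewrite /G /christoffel1 !partial_tau_taub_nut partial_rad_gtt.
rewrite !(@partial_rad_gtr _ irad itau) ?(@partial_rad_gtr _ itau irad);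
  do ?[by left|by right].
by split; ring.
Qed.

Lemma christoffel1_rad x (G := christoffel1 (taub_nut n) x irad) :
  [/\ G itau itau = - (2^-1 * derive1 gtt (x 0 irad)), G itau irad = 0,
      G irad itau = 0 & G irad irad = 2^-1 * derive1 grr (x 0 irad)].
Proof.
rewrite /G /christoffel1 !partial_tau_taub_nut partial_rad_gtt partial_rad_grr.
rewrite !(@partial_rad_gtr _ irad itau) ?(@partial_rad_gtr _ itau irad);
  do ?[by left|by right].
by split; ring.
Qed.

Lemma sum4_radial (a : 'I_4 -> R) (G : 'I_4 -> 'I_4 -> R) :
  a itheta = 0 -> a iphi = 0 ->
  \sum_i \sum_j G i j * a i * a j =
    G itau itau * a itau ^+ 2 + (G itau irad + G irad itau) * a itau * a irad
    + G irad irad * a irad ^+ 2.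
Proof. by move=> a2 a3; rewrite !big_ord4 a2 a3; ring. Qed.

(** When the angles are at rest, the tau- and r-components of the lowered
    equation only see the (tau, r)-block diag(gtt, grr) of the metric. They are
    the Euler-Lagrange equations of (gtt tau'^2 + grr r'^2) / 2. *)
Lemma radial_geodesic_eqs I (c : R -> 'rV[R]_4) s :
  0 < n -> n < c s 0 irad -> sin (c s 0 itheta) != 0 ->
  geodesic (taub_nut n) I c -> s \in I ->
  (forall k, k \in [:: itheta; iphi] ->
    derive1 (curve_coord c k) s = 0 /\
    derive1 (derive1 (curve_coord c k)) s = 0) ->
  let r := c s 0 irad in
  let dtau := derive1 (curve_coord c itau) in
  let dr := derive1 (curve_coord c irad) in
  gtt r * derive1 dtau s + derive1 gtt r * dr s * dtau s = 0 /\
  grr r * derive1 dr s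
    + 2^-1 * (derive1 grr r * dr s ^+ 2 - derive1 gtt r * dtau s ^+ 2) = 0.
Proof.
move=> n0 nr st geo sI ang r dtau dr.
have rn : (r - n != 0) && (r + n != 0).
  by rewrite subr_eq0 gt_eqF// gt_eqF// addr_gt0// (lt_trans n0 nr).
have gU := taub_nut_unit n0 nr st.
have [t1 t2] := ang itheta isT; have [p1 p2] := ang iphi isT.
pose a k : R := derive1 (curve_coord c k) s.
pose b k : R := derive1 (derive1 (curve_coord c k)) s.
have [Gt0 Gt1 Gt2 Gt3] := christoffel1_tau (c s).
have [Gr0 Gr1 Gr2 Gr3] := christoffel1_rad (c s).
have eq k : \sum_l taub_nut n (c s) k l * b l
    + \sum_i \sum_j christoffel1 (taub_nut n) (c s) k i j * a i * a j = 0.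
  exact: geodesic_lowered geo sI gU.
have b2 : b itheta = 0 := t2.
have b3 : b iphi = 0 := p2.
have eqt := eq itau; have eqr := eq irad.
rewrite sum4_radial // ?Gt0 ?Gt1 ?Gt2 ?Gt3 big_ord4 b2 b3 in eqt.
rewrite sum4_radial // ?Gr0 ?Gr1 ?Gr2 ?Gr3 big_ord4 b2 b3 in eqr.
rewrite !taub_nutE /= -/r in eqt eqr.
rewrite -[derive1 dtau s]/(b itau) -[derive1 dr s]/(b irad).
rewrite -[dtau s]/(a itau) -[dr s]/(a irad) [gtt r]/gtt [grr r]/grr.
move: (derive1 gtt r) (derive1 grr r) eqt eqr => u w eqt eqr.
(* Both identities are rational in independent quantities from here on. *)
clearbody a b r; clear -rn eqt eqr.
by split; [rewrite -[RHS]eqt|rewrite -[RHS]eqr]; field.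
Qed.

End Metric.

(** * Integration of a separable equation along a monotone curve *)

Section Quadrature.
Context {R : realType}.
Implicit Types (I : interval R) (f rho : R -> R).

Lemma is_derive_derive1 f s : derivable f s 1 -> is_derive s 1 f (derive1 f s).
Proof. by move=> fs; rewrite derive1E; exact: derivableP. Qed.

Lemma derivable_continuous f s : derivable f s 1 -> {for s, continuous f}.
Proof. by move=> /derivable1_diffP/differentiable_continuous. Qed.

Lemma is_derive1E f (s df : R) : is_derive s 1 f df -> derive1 f s = df.
Proof. by move=> [_ <-]; rewrite derive1E. Qed.

Lemma cvg_near_cst_eq (F : set_system R) (FF : ProperFilter F) (u : R -> R) a l :
  (\forall x \near F, u x = a) -> u x @[x --> F] --> l -> l = a.
Proof.
by move=> ua; apply: (@closed_cvg _ _ F _ u [set a]) => //; exact: closed_eq.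
Qed.

Definition strictly_monotone I rho :=
  {in I &, {homo rho : x y / x < y}} \/ {in I &, {homo rho : x y /~ x < y}}.

(** The same sign serves at all points of I, although the derivative may vanish
    at a turning point; sig records the direction of the motion. *)
Lemma strictly_monotone_derive1_sign I rho s s' :
  s \in I -> s' \in I -> s != s' ->
  (forall u, u \in I -> derivable rho u 1) -> strictly_monotone I rho ->
  exists2 sig : R, sig = 1 \/ sig = -1 &
    forall u, u \in I -> 0 <= sig * derive1 rho u.
Proof.
move=> sI s'I ss' drho mono.
have other u : exists2 v, v \in I & u != v.
  by have [->|us] := eqVneq u s; [exists s'|exists s].
case: mono => mono.
  exists 1; first by left.
  move=> u uI; have [v vI uv] := other u; rewrite mul1r.
  exact: derive1_ge0_itv uI vI uv (drho u uI) mono.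
exists (-1); first by right.
move=> u uI; have [v vI uv] := other u; rewrite mulN1r.
have Dn := is_deriveN (is_derive_derive1 (drho u uI)).
rewrite -(is_derive1E Dn).
apply: derive1_ge0_itv uI vI uv _ _; first by case: Dn.
by move=> x y xI yI xy; rewrite ltrN2 mono.
Qed.

(** f - G o rho has zero derivative where R1 < rho. Monotonicity of rho makes
    that region an interval, on which f - G o rho is therefore constant, with
    value l - G R1 by the limit at R1. At most one point of I is left out, the
    turning point rho = R1, where G need not be differentiable; the identity
    extends to it by continuity. *)
Lemma quadrature I rho f (G dG t : R -> R) R1 l s s' :
  s \in I -> s' \in I -> s != s' ->
  (forall u, u \in I -> derivable rho u 1) ->
  (forall u, u \in I -> derivable f u 1) ->
  strictly_monotone I rho ->
  (forall u, u \in I -> R1 <= rho u) ->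
  (forall r, R1 < r -> is_derive r 1 G (dG r)) ->
  {for R1, continuous G} ->
  (forall u, u \in I -> R1 < rho u ->
     derive1 f u = dG (rho u) * derive1 rho u) ->
  (\forall r \near R1^'+, t r \in I /\ rho (t r) = r) ->
  f (t r) @[r --> R1^'+] --> l ->
  forall u, u \in I -> f u = l + (G (rho u) - G R1).
Proof.
move=> sI s'I ss' drho df mono rhoR1 DG GR1 dfE tP fl.
pose h := f - (G \o rho).
have Dh u : u \in I -> R1 < rho u -> is_derive u 1 h 0.
  move=> uI ur; have Df := is_derive_derive1 (df u uI).
  have DGr := is_derive1_comp (DG _ ur) (is_derive_derive1 (drho u uI)).
  apply: (is_derive_eq (is_deriveB Df DGr)).
  by rewrite dfE // subrr.
have lt_cst a b : a \in I -> b \in I -> R1 < rho a -> R1 < rho b -> a < b ->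
    h a = h b.
  move=> aI bI ra rb ab.
  have sub x : x \in `[a, b] -> x \in I /\ R1 < rho x.
    rewrite in_itv /= => axb.
    have xI : x \in I by exact: (@interval_is_interval _ I a b).
    split=> //; case/andP: axb; rewrite !le_eqVlt.
    move=> /orP[/eqP<-//|ax] /orP[/eqP->//|xb].
    case: mono => mono; [apply: (lt_trans ra)|apply: (lt_trans rb)]; exact: mono.
  apply: (@derive1_eq0_cst_itv _ `[a, b]); rewrite ?in_itv/= ?lexx ?ltW//.
  by move=> u /sub[uI ru]; exact: Dh.
have h_cst a b : a \in I -> b \in I -> R1 < rho a -> R1 < rho b -> h a = h b.
  move=> aI bI ra rb; case: (ltgtP a b) => [|ba|->//]; first exact: lt_cst.
  by rewrite (lt_cst b a).
have h_gt u : u \in I -> R1 < rho u -> h u = l - G R1.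
  move=> uI ru; apply/esym.
  apply: (@cvg_near_cst_eq R1^'+ _ (fun r => f (t r) - G r)).
    near=> r.
    have [tI tr] : t r \in I /\ rho (t r) = r by near: r.
    have r1 : R1 < r by near: r; exact: nbhs_right_gt.
    rewrite (h_cst u (t r)) ?tr// /h.
    by rewrite -[RHS]/(f (t r) - G (rho (t r))) tr.
  by apply: cvgB => //; apply: cvg_at_right_filter.
suff h_eq u : u \in I -> h u = l - G R1.
  by move=> u /h_eq hu; rewrite addrCA -hu /h /= addrC subrK.
move=> uI; case: (ltgtP R1 (rho u)) (rhoR1 u uI) => // [ru _|ru _].
  exact: h_gt.
have [v vI uv] : exists2 v, v \in I & u != v.
  by have [->|us] := eqVneq u s; [exists s'|exists s].
apply: (continuous_eq_itv uI vI uv) => [|x xI xu].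
  apply: cvgB; first exact: derivable_continuous (df u uI).
  apply: continuous_comp; first exact: derivable_continuous (drho u uI).
  by rewrite -ru.
apply: h_gt => //; rewrite lt_neqAle rhoR1// andbT ru.
apply/eqP => rux; case: mono => mono; case: (ltgtP x u) xu => // xu _.
- by have := mono _ _ xI uI xu; rewrite rux ltxx.
- by have := mono _ _ uI xI xu; rewrite rux ltxx.
- by have := mono _ _ uI xI xu; rewrite rux ltxx.
- by have := mono _ _ xI uI xu; rewrite rux ltxx.
Unshelve. all: by end_near. Qed.

End Quadrature.

(** * First integrals *)

Section FirstIntegrals.
Context {R : realType}.
Implicit Types (n r : R).

Lemma is_derive_gtt n r : r + n != 0 ->
  is_derive r 1 (gtt n) (2 * n / (r + n) ^+ 2).
Proof.
move=> rn.
have D1 := is_deriveB (is_derive_id r (1 : R)) (is_derive_cst n r (1 : R)).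
have D2 := is_deriveD (is_derive_id r (1 : R)) (is_derive_cst n r (1 : R)).
apply: (is_derive_eq (is_deriveM D1 (is_deriveV (f := id + cst n) rn D2))).
rewrite /GRing.scale /= -[(id - cst n) r]/(r - n) -[(id + cst n) r]/(r + n).
by rewrite -exprVn; field.
Qed.

Lemma is_derive_grr n r : r - n != 0 ->
  is_derive r 1 (grr n) (- (2 * n / (r - n) ^+ 2)).
Proof.
move=> rn.
have D1 := is_deriveB (is_derive_id r (1 : R)) (is_derive_cst n r (1 : R)).
have D2 := is_deriveD (is_derive_id r (1 : R)) (is_derive_cst n r (1 : R)).
apply: (is_derive_eq (is_deriveM D2 (is_deriveV (f := id - cst n) rn D1))).
rewrite /GRing.scale /= -[(id - cst n) r]/(r - n) -[(id + cst n) r]/(r + n).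
by rewrite -exprVn; field.
Qed.

(** The two conservation laws: the momentum of the cyclic coordinate tau, and
    the squared speed. Their derivatives are combinations of the two geodesic
    equations. *)
Lemma radial_first_integrals n (I : interval R) (rho ta : R -> R) :
  0 < n -> (forall u, u \in I -> n < rho u) ->
  (forall u, u \in I -> derivable rho u 1) ->
  (forall u, u \in I -> derivable (derive1 rho) u 1) ->
  (forall u, u \in I -> derivable (derive1 ta) u 1) ->
  (forall u, u \in I ->
    gtt n (rho u) * derive1 (derive1 ta) u
      + derive1 (gtt n) (rho u) * derive1 rho u * derive1 ta u = 0 /\
    grr n (rho u) * derive1 (derive1 rho) u + 2^-1 *
      (derive1 (grr n) (rho u) * derive1 rho u ^+ 2
       - derive1 (gtt n) (rho u) * derive1 ta u ^+ 2) = 0) ->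
  forall a b, a \in I -> b \in I ->
    gtt n (rho a) * derive1 ta a = gtt n (rho b) * derive1 ta b /\
    gtt n (rho a) * derive1 ta a ^+ 2 + grr n (rho a) * derive1 rho a ^+ 2 =
    gtt n (rho b) * derive1 ta b ^+ 2 + grr n (rho b) * derive1 rho b ^+ 2.
Proof.
move=> n0 nrho D1rho D2rho D2ta eqs a b aI bI.
have Dg u : u \in I -> is_derive u 1 (gtt n \o rho)
    (derive1 (gtt n) (rho u) * derive1 rho u).
  move=> uI; have rn : rho u + n != 0.
    by rewrite gt_eqF// addr_gt0// (lt_trans n0)// nrho.
  apply: is_derive1_comp; last exact: is_derive_derive1 (D1rho u uI).
  by apply: is_derive_derive1; case: (is_derive_gtt rn).
have Dh u : u \in I -> is_derive u 1 (grr n \o rho)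
    (derive1 (grr n) (rho u) * derive1 rho u).
  move=> uI; have rn : rho u - n != 0 by rewrite subr_eq0 gt_eqF// nrho.
  apply: is_derive1_comp; last exact: is_derive_derive1 (D1rho u uI).
  by apply: is_derive_derive1; case: (is_derive_grr rn).
pose p := (gtt n \o rho) * derive1 ta.
pose e := (gtt n \o rho) * derive1 ta ^+ 2 + (grr n \o rho) * derive1 rho ^+ 2.
have sqE (f g : R -> R) u : f u * g u ^+ 2 = (f * g ^+ 2) u by [].
have pE u : gtt n (rho u) * derive1 ta u = p u by [].
have eE u : gtt n (rho u) * derive1 ta u ^+ 2
    + grr n (rho u) * derive1 rho u ^+ 2 = e u.
  exact: congr2 (sqE _ _ u) (sqE _ _ u).
have Dp u : u \in I -> is_derive u 1 p 0.
  move=> uI; have [eqt _] := eqs u uI.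
  apply: (is_derive_eq (is_deriveM (Dg u uI) (is_derive_derive1 (D2ta u uI)))).
  by rewrite -[RHS]eqt /GRing.scale /= [derive1 ta u * _]mulrC.
have De u : u \in I -> is_derive u 1 e 0.
  move=> uI; have [eqt eqr] := eqs u uI.
  have E1 := is_deriveM (Dg u uI) (is_deriveX 2 (is_derive_derive1 (D2ta u uI))).
  have E2 := is_deriveM (Dh u uI) (is_deriveX 2 (is_derive_derive1 (D2rho u uI))).
  apply: (is_derive_eq (is_deriveD E1 E2)).
  rewrite /GRing.scale /= -[(_ ^+ 2) u]/(derive1 ta u ^+ 2).
  rewrite -[(derive1 rho ^+ 2) u]/(derive1 rho u ^+ 2).
  move: eqt eqr; move: (gtt n (rho u)) (grr n (rho u)) (derive1 (gtt n) (rho u))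
    (derive1 (grr n) (rho u)) (derive1 ta u) (derive1 rho u)
    (derive1 (derive1 ta) u) (derive1 (derive1 rho) u).
  clear => A B A' B' y x y2 x2 eqt eqr.
  (* The derivative of the squared speed is 2 y times the tau-equation plus
     2 x times the r-equation, x and y being the velocities of r and tau. *)
  have -> : 0 = 2 * y * 0 + 2 * x * 0 :> R by rewrite !mulr0 addr0.
  by rewrite -{1}eqt -eqr; field.
clearbody p e; rewrite !pE !eE; split.
  exact: (derive1_eq0_cst_itv Dp).
exact: (derive1_eq0_cst_itv De).
Qed.

End FirstIntegrals.

(** * The two primitives *)

Section Primitives.
Context {R : realType}.
Context (n R1 : R) (n0 : 0 < n) (nR1 : n < R1).

Definition log_part (r : R) :=
  ln ((Num.sqrt (r - R1) + Num.sqrt (r + n)) / Num.sqrt (R1 + n)).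
Definition atan_part (r : R) :=
  atan (Num.sqrt (2 * n) * Num.sqrt (r - R1)
        / (Num.sqrt (R1 - n) * Num.sqrt (r + n))).
Definition prim_t (r : R) :=
  Num.sqrt (r - R1) * Num.sqrt (r + n) + (n + R1) * log_part r.
Definition prim_tau (r : R) :=
  (5 * n + R1) * log_part r
  + 2 * (2 * n) `^ (3 / 2) / Num.sqrt (R1 - n) * atan_part r
  + Num.sqrt (r - R1) * Num.sqrt (r + n).

Lemma is_derive_sqrt_shift (r k : R) : 0 < r + k ->
  is_derive r 1 (fun x => Num.sqrt (x + k)) (2 * Num.sqrt (r + k))^-1.
Proof.
move=> rk.
have D := is_deriveD (is_derive_id r (1 : R)) (is_derive_cst k r (1 : R)).
have S := @is_derive1_sqrt _ ((id + cst k) r) rk.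
apply: (is_derive_eq (is_derive1_comp S D)).
by rewrite addr0 mulr1.
Qed.

Section AtPoint.
Context (r : R) (R1r : R1 < r).
Let a := Num.sqrt (r - R1).
Let b := Num.sqrt (r + n).
Let rR1 : 0 < r - R1. Proof. by rewrite subr_gt0. Qed.
Let rn : 0 < r + n.
Proof. by rewrite addr_gt0// (lt_trans n0)// (lt_trans nR1). Qed.
Let R1n : 0 < R1 + n. Proof. by rewrite addr_gt0// (lt_trans n0). Qed.
Let a0 : 0 < a. Proof. by rewrite sqrtr_gt0. Qed.
Let b0 : 0 < b. Proof. by rewrite sqrtr_gt0. Qed.
Let a2 : a ^+ 2 = r - R1. Proof. by rewrite sqr_sqrtr// ltW. Qed.
Let b2 : b ^+ 2 = r + n. Proof. by rewrite sqr_sqrtr// ltW. Qed.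
Let Da := is_derive_sqrt_shift rR1.
Let Db := is_derive_sqrt_shift rn.

Lemma is_derive_sqrt_prod :
  is_derive r 1 (fun x => Num.sqrt (x - R1) * Num.sqrt (x + n))
    ((a ^+ 2 + b ^+ 2) / (2 * a * b)).
Proof.
apply: (is_derive_eq (is_deriveM Da Db)).
rewrite /GRing.scale /= -/a -/b; field.
by rewrite !gt_eqF.
Qed.

Lemma is_derive_log_part : is_derive r 1 log_part (2 * a * b)^-1.
Proof.
have k0 : 0 < Num.sqrt (R1 + n) by rewrite sqrtr_gt0.
pose g x := (Num.sqrt (x - R1) + Num.sqrt (x + n)) / Num.sqrt (R1 + n).
have g0 : 0 < g r by rewrite divr_gt0// addr_gt0.
have Dg : is_derive r 1 g _ := is_deriveM (is_deriveD Da Db)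
  (is_derive_cst (Num.sqrt (R1 + n))^-1 r (1 : R)).
apply: (is_derive_eq (is_derive1_comp (is_derive1_ln g0) Dg)).
rewrite /g /GRing.scale /= mulr0 add0r /cst -/a -/b; field.
by rewrite !gt_eqF// addr_gt0.
Qed.

(** The denominator factors: (R1 - n) (r + n) + 2 n (r - R1) =
    (R1 + n) (r - n). This is where the pole at r = n comes from. *)
Lemma is_derive_atan_part : is_derive r 1 atan_part
  (Num.sqrt (2 * n) * Num.sqrt (R1 - n) / (2 * a * b * (r - n))).
Proof.
pose k := Num.sqrt (2 * n); pose m := Num.sqrt (R1 - n).
have k2 : k ^+ 2 = 2 * n by rewrite sqr_sqrtr// mulr_ge0// ltW.
have m2 : m ^+ 2 = R1 - n by rewrite sqr_sqrtr// subr_ge0 ltW.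
have m0 : 0 < m by rewrite sqrtr_gt0 subr_gt0.
have mb0 : m * b != 0 by rewrite gt_eqF// mulr_gt0.
pose g x := k * Num.sqrt (x - R1) / (m * Num.sqrt (x + n)).
have D1 := is_deriveM (is_derive_cst k r (1 : R)) Da.
have D2 : is_derive r 1 (fun x => m * Num.sqrt (x + n)) _ :=
  is_deriveM (is_derive_cst m r (1 : R)) Db.
have Dg : is_derive r 1 g _ :=
  is_deriveM D1 (is_deriveV (f := fun x => m * Num.sqrt (x + n)) mb0 D2).
apply: (is_derive_eq (is_derive1_comp (is_derive1_atan (g r)) Dg)).
rewrite /g /GRing.scale /= !mulr0 !addr0 -[(cst k * _) r]/(k * a) /cst /=.
rewrite -/a -/b -/k -/m -exprVn.
have b2a2 : b ^+ 2 - a ^+ 2 = R1 + n by rewrite a2 b2; ring.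
have mbka : m ^+ 2 * b ^+ 2 + k ^+ 2 * a ^+ 2 = (R1 + n) * (r - n).
  by rewrite m2 b2 k2 a2; ring.
have -> : 1 + (k * a / (m * b)) ^+ 2 =
    (m ^+ 2 * b ^+ 2 + k ^+ 2 * a ^+ 2) / (m ^+ 2 * b ^+ 2).
  by field; rewrite !gt_eqF.
have -> : k * a * (- (m * b)^-1 ^+ 2 * (m / (2 * b))) + (m * b)^-1 * (k / (2 * a))
    = k * (b ^+ 2 - a ^+ 2) / (2 * a * m * b ^+ 3).
  by field; rewrite !gt_eqF.
have rn0 : r - n != 0 by rewrite subr_eq0 gt_eqF// (lt_trans nR1).
rewrite b2a2 mbka; clearbody a b k m; field.
by rewrite rn0 !gt_eqF.
Qed.

Lemma is_derive_prim_t : is_derive r 1 prim_t (b / a).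
Proof.
have D : is_derive r 1 prim_t _ := is_deriveD is_derive_sqrt_prod
  (is_deriveM (is_derive_cst (n + R1) r (1 : R)) is_derive_log_part).
apply: (is_derive_eq D); rewrite /GRing.scale /= mulr0 addr0 /cst.
have -> : n + R1 = b ^+ 2 - a ^+ 2 by rewrite a2 b2; ring.
by clearbody a b; field; rewrite !gt_eqF.
Qed.

(** With a = sqrt (r - R1), b = sqrt (r + n), the logarithm and the product
    contribute (r + 3 n) / (a b), the arctangent 4 n^2 / (a b (r - n)), and
    (r + 3 n) (r - n) + 4 n^2 = (r + n)^2. *)
Lemma is_derive_prim_tau : is_derive r 1 prim_tau ((r + n) / (r - n) * (b / a)).
Proof.
have k2 : Num.sqrt (2 * n) ^+ 2 = 2 * n by rewrite sqr_sqrtr// mulr_ge0// ltW.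
have k32 : (2 * n) `^ (3 / 2) = 2 * n * Num.sqrt (2 * n).
  have -> : 3 / 2 = 1 + 2^-1 :> R by field.
  rewrite powRD; last by apply/implyP => _; rewrite gt_eqF// mulr_gt0.
  by rewrite powRr1 ?powR12_sqrt// mulr_ge0// ltW.
have m0 : 0 < Num.sqrt (R1 - n) by rewrite sqrtr_gt0 subr_gt0.
have D : is_derive r 1 prim_tau _ := is_deriveD (is_deriveD
  (is_deriveM (is_derive_cst (5 * n + R1) r (1 : R)) is_derive_log_part)
  (is_deriveM (is_derive_cst (2 * (2 * n) `^ (3 / 2) / Num.sqrt (R1 - n)) r (1 : R))
     is_derive_atan_part)) is_derive_sqrt_prod.
apply: (is_derive_eq D); rewrite /GRing.scale /= !mulr0 !addr0 /cst k32.
move: (Num.sqrt (R1 - n)) m0 (Num.sqrt (2 * n)) k2 => m m0 k k2.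
have rn0 : r - n != 0 by rewrite subr_eq0 gt_eqF// (lt_trans nR1).
have -> : 5 * n + R1 = b ^+ 2 - a ^+ 2 + 4 * n by rewrite a2 b2; ring.
have -> : 2 * (2 * n * k) / m * (k * m / (2 * a * b * (r - n))) =
    k ^+ 2 * 2 * n / (a * b * (r - n)).
  by clearbody a b; field; rewrite rn0 !gt_eqF.
have rE : r = b ^+ 2 - n by rewrite b2; ring.
rewrite k2; clearbody a b; move: rn0; rewrite rE => rn0; field.
by rewrite rn0 !gt_eqF.
Qed.

End AtPoint.

Lemma log_part_R1 : log_part R1 = 0.
Proof.
rewrite /log_part subrr sqrtr0 add0r divff ?ln1// gt_eqF// sqrtr_gt0.
by rewrite addr_gt0// (lt_trans n0).
Qed.

Lemma atan_part_R1 : atan_part R1 = 0.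
Proof. by rewrite /atan_part subrr sqrtr0 mulr0 mul0r atan0. Qed.

Lemma prim_t_R1 : prim_t R1 = 0.
Proof. by rewrite /prim_t log_part_R1 subrr sqrtr0 mul0r mulr0 addr0. Qed.

Lemma prim_tau_R1 : prim_tau R1 = 0.
Proof.
by rewrite /prim_tau log_part_R1 atan_part_R1 subrr sqrtr0 mul0r !mulr0 !addr0.
Qed.

Let continuous_sqrt_shift (k x : R) :
  {for x, continuous (fun r => Num.sqrt (r + k))}.
Proof.
apply: continuous_comp; last exact: sqrt_continuous.
by apply: cvgD; [exact: cvg_id|exact: cvg_cst].
Qed.

Lemma continuous_sqrt_prod :
  {for R1, continuous (fun r => Num.sqrt (r - R1) * Num.sqrt (r + n))}.
Proof. by apply: cvgM; exact: continuous_sqrt_shift. Qed.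

Lemma continuous_log_part : {for R1, continuous log_part}.
Proof.
have R1n : 0 < Num.sqrt (R1 + n).
  by rewrite sqrtr_gt0 addr_gt0// (lt_trans n0).
apply: continuous_comp.
  by apply: cvgMl; apply: cvgD; exact: continuous_sqrt_shift.
by apply: continuous_ln; rewrite divr_gt0// subrr sqrtr0 add0r.
Qed.

Lemma continuous_atan_part : {for R1, continuous atan_part}.
Proof.
have R1n : 0 < Num.sqrt (R1 + n).
  by rewrite sqrtr_gt0 addr_gt0// (lt_trans n0).
have m0 : 0 < Num.sqrt (R1 - n) by rewrite sqrtr_gt0 subr_gt0.
apply: continuous_comp; last exact: continuous_atan.
apply: cvgM; first by apply: cvgMr; exact: continuous_sqrt_shift.
apply: cvgV; first by rewrite mulf_neq0// gt_eqF.
by apply: cvgMr; exact: continuous_sqrt_shift.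
Qed.

Lemma continuous_prim_t : {for R1, continuous prim_t}.
Proof.
apply: cvgD; first exact: continuous_sqrt_prod.
by apply: cvgMr; exact: continuous_log_part.
Qed.

Lemma continuous_prim_tau : {for R1, continuous prim_tau}.
Proof.
apply: cvgD; last exact: continuous_sqrt_prod.
apply: cvgD; first by apply: cvgMr; exact: continuous_log_part.
by apply: cvgMr; exact: continuous_atan_part.
Qed.

End Primitives.

(** * The radial velocity and the geodesics *)

Section RadialVelocity.
Context {R : realType}.

(** The range of rho contains an interval, so that I is not reduced to a point. *)
Lemma two_points_right (I : interval R) (rho : R -> R) R1 :
  (\forall r \near R1^'+, exists2 s, s \in I & rho s = r) ->
  exists s s', [/\ s \in I, s' \in I & s != s'].
Proof.
move=> [e /= e0 eP].
have pt k : 0 < k < e -> exists2 s, s \in I & rho s = R1 + k.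
  move=> /andP[k0 ke]; apply: eP; last by rewrite /= ltrDl.
  by rewrite /ball_ /= opprD addNKr normrN gtr0_norm.
have [|s sI sE] := pt (e / 2); first by lra.
have [|s' s'I s'E] := pt (e / 3); first by lra.
exists s, s'; split => //; apply/eqP => ss'.
by move: sE; rewrite ss' s'E => /addrI; lra.
Qed.

Lemma angles_at_rest (I : interval R) m (g : 'rV[R]_m.+1 -> 'M[R]_m.+1)
    (c : R -> 'rV[R]_m.+1) k a s s' :
  s \in I -> s' \in I -> s != s' -> geodesic g I c ->
  (forall u, u \in I -> c u 0 k = a) ->
  forall u, u \in I -> derive1 (curve_coord c k) u = 0 /\
                       derive1 (derive1 (curve_coord c k)) u = 0.
Proof.
move=> sI s'I ss' geo ca.
have other u : exists2 v, v \in I & u != v.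
  by have [->|us] := eqVneq u s; [exists s'|exists s].
have d0 u : u \in I -> derive1 (curve_coord c k) u = 0.
  move=> uI; have [v vI uv] := other u; have [d1 _ _] := geo u uI k.
  exact: derive1_cst_itv uI vI uv (nbhs_singleton d1) ca.
move=> u uI; split; first exact: d0.
have [v vI uv] := other u; have [_ d2 _] := geo u uI k.
exact: derive1_cst_itv uI vI uv d2 d0.
Qed.

(** The square root of the energy equation is taken with the same sign on all
    of I, since rho is monotone. As r1 may be negative, eps is the direction of
    the motion times the sign of r1. *)
Lemma radial_speed_sign (I : interval R) (rho : R -> R) n R1 r1 s s' :
  s \in I -> s' \in I -> s != s' -> r1 != 0 ->
  (forall u, u \in I -> derivable rho u 1) -> strictly_monotone I rho ->
  (forall u, u \in I -> R1 <= rho u /\ 0 < rho u + n) ->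
  (forall u, u \in I ->
     derive1 rho u ^+ 2 = r1 ^+ 2 * (rho u - R1) / (rho u + n)) ->
  exists2 eps : R, eps = 1 \/ eps = -1 & forall u, u \in I ->
    derive1 rho u = eps * r1 * (Num.sqrt (rho u - R1) / Num.sqrt (rho u + n)).
Proof.
move=> sI s'I ss' r10 drho mono rhoB d2.
have [sig sigE sig_ge0] := strictly_monotone_derive1_sign sI s'I ss' drho mono.
have sig2 : sig ^+ 2 = 1 by case: sigE => ->; rewrite ?sqrrN expr1n.
exists (sig * Num.sg r1).
  have [/ltr0_sg->|/gtr0_sg->|r1E] := ltgtP r1 0; last by rewrite r1E eqxx in r10.
    by case: sigE => ->; rewrite ?mul1r ?mulrNN ?mulr1; [right|left].
  by case: sigE => ->; rewrite mulr1; [left|right].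
move=> u uI; have [ra rb] := rhoB u uI.
have a2 : Num.sqrt (rho u - R1) ^+ 2 = rho u - R1.
  by rewrite sqr_sqrtr// subr_ge0.
have b2 : Num.sqrt (rho u + n) ^+ 2 = rho u + n by rewrite sqr_sqrtr// ltW.
have H : sig * derive1 rho u =
    `|r1| * (Num.sqrt (rho u - R1) / Num.sqrt (rho u + n)).
  apply/eqP; rewrite -(@eqrXn2 _ 2)// ?sig_ge0 ?mulr_ge0 ?invr_ge0 ?sqrtr_ge0//.
  rewrite !exprMn exprVn a2 b2 sig2 mul1r d2// real_normK ?num_real//.
  by rewrite mulrA.
by rewrite -(mulrA sig) -normrEsg -mulrA -H mulrA -expr2 sig2 mul1r.
Qed.

End RadialVelocity.

(* The curve c, with parameter in I, is the geodesic; t and tau are its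
   parameter and its tau-coordinate expressed as functions of r. The argument
   of ln is divided by its value at r = R1, so that the formulas agree with
   the initial values t1 and tau1. *)
Theorem theorem3p2 (R : realType) (n r1 tau0 t1 tau1 theta0 phi0 : R)
    (I : interval R) (c : R -> 'rV[R]_4) (t tau : R -> R) :
  let R1 := n + 2 * tau0 ^+ 2 * n / r1 ^+ 2 in
  r1 != 0 ->
  n < R1 ->
  sin theta0 != 0 ->
  geodesic (taub_nut n) I c ->
  (forall s, s \in I -> c s 0 itheta = theta0) ->
  (forall s, s \in I -> c s 0 iphi = phi0) ->
  (forall s, s \in I -> R1 <= c s 0 irad) ->
  (forall s, s \in I -> t (c s 0 irad) = s) ->
  (forall s, s \in I -> tau (c s 0 irad) = c s 0 itau) ->
  (\forall r \near R1^'+, exists2 s, s \in I & c s 0 irad = r) ->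
  t r @[r --> R1^'+] --> t1 ->
  tau r @[r --> R1^'+] --> tau1 ->
  (r - n) / (r + n) * derive1 (curve_coord c itau) (t r) @[r --> R1^'+] --> tau0 ->
  (r + n) / (r - n) * (derive1 (curve_coord c irad) (t r)) ^+ 2
    + 2 * tau0 ^+ 2 * n / (r - n) @[r --> R1^'+] --> r1 ^+ 2 ->
  exists eps : R, (eps = 1 \/ eps = -1) /\
    forall s, s \in I -> forall r, r = c s 0 irad ->
      t r = t1 + eps / r1 *
        (Num.sqrt (r - R1) * Num.sqrt (r + n)
         + (n + R1) * ln ((Num.sqrt (r - R1) + Num.sqrt (r + n))
                          / Num.sqrt (R1 + n)))
      /\
      tau r = tau1 + eps * tau0 / r1 *
        ((5 * n + R1) * ln ((Num.sqrt (r - R1) + Num.sqrt (r + n))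
                            / Num.sqrt (R1 + n))
         + 2 * (2 * n) `^ (3 / 2) / Num.sqrt (R1 - n)
           * atan (Num.sqrt (2 * n) * Num.sqrt (r - R1)
                   / (Num.sqrt (R1 - n) * Num.sqrt (r + n)))
         + Num.sqrt (r - R1) * Num.sqrt (r + n)).
Proof.
move=> R1 r10 nR1 st geo cth cph rR1 tc tauc nearI t1l tau1l p_lim e_lim.
have n0 : 0 < n.
  have : 0 < 2 * tau0 ^+ 2 * n / r1 ^+ 2 by rewrite -subr_gt0 /R1 in nR1; lra.
  rewrite pmulr_lgt0 ?invr_gt0 ?exprn_even_gt0//.
  have := sqr_ge0 tau0; nra.
pose rho := curve_coord c irad; pose ta := curve_coord c itau.
have [s0 [s1 [s0I s1I s01]]] := two_points_right nearI.
have nr u : u \in I -> n < rho u by move=> uI; exact: lt_le_trans (rR1 u uI).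
have rmn u : u \in I -> rho u - n != 0.
  by move=> uI; rewrite subr_eq0 gt_eqF// nr.
have rpn u : u \in I -> 0 < rho u + n.
  by move=> uI; rewrite addr_gt0// (lt_trans n0)// nr.
have drv k u : u \in I -> derivable (curve_coord c k) u 1.
  by move=> uI; have [d _ _] := geo u uI k; exact: nbhs_singleton d.
have drv2 k u : u \in I -> derivable (derive1 (curve_coord c k)) u 1.
  by move=> uI; have [_ d _] := geo u uI k.
have near_t : \forall r \near R1^'+, t r \in I /\ rho (t r) = r.
  near=> r; have [s sI sr] : exists2 s, s \in I & c s 0 irad = r by near: r.
  by rewrite -sr tc.
have rest k : k \in [:: itheta; iphi] -> forall u, u \in I ->
    derive1 (curve_coord c k) u = 0 /\
    derive1 (derive1 (curve_coord c k)) u = 0.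
  rewrite !inE => /orP[/eqP->|/eqP->].
    exact: angles_at_rest s0I s1I s01 geo cth.
  exact: angles_at_rest s0I s1I s01 geo cph.
have eqs u (uI : u \in I) : _ /\ _ := radial_geodesic_eqs n0 (nr u uI)
  (eq_ind_r (fun x => sin x != 0) st (cth u uI)) geo uI
  (fun k kang => rest k kang u uI).
have ints := radial_first_integrals n0 nr (drv irad) (drv2 irad) (drv2 itau) eqs.
have pE u : u \in I -> gtt n (rho u) * derive1 ta u = tau0.
  move=> uI; apply/esym; apply: cvg_near_cst_eq p_lim.
  near=> r; have [tI tr] : t r \in I /\ rho (t r) = r by near: r.
  by have [<- _] := ints (t r) u tI uI; rewrite tr.
have dtaE u : u \in I -> derive1 ta u = (rho u + n) / (rho u - n) * tau0.
  move=> uI; rewrite -(pE u uI) /gtt; field.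
  by rewrite rmn// gt_eqF// rpn.
(* With the momentum tau0, gtt tau'^2 = tau0^2 (r + n) / (r - n), which is
   tau0^2 + 2 tau0^2 n / (r - n); the second limit thus gives the squared
   speed, up to the constant tau0^2. *)
have eE u : u \in I -> grr n (rho u) * derive1 rho u ^+ 2
    + 2 * tau0 ^+ 2 * n / (rho u - n) = r1 ^+ 2.
  move=> uI; apply/esym; apply: cvg_near_cst_eq e_lim.
  near=> r; have [tI tr] : t r \in I /\ rho (t r) = r by near: r.
  have e2 v : v \in I -> grr n (rho v) * derive1 rho v ^+ 2
      + 2 * tau0 ^+ 2 * n / (rho v - n) =
      gtt n (rho v) * derive1 ta v ^+ 2 + grr n (rho v) * derive1 rho v ^+ 2
      - tau0 ^+ 2.
    move=> vI; rewrite dtaE// /gtt /grr; field.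
    by rewrite rmn// gt_eqF// rpn.
  have [_ eq] := ints (t r) u tI uI.
  by have := e2 (t r) tI; rewrite eq -(e2 u uI) tr.
(* R1 is the radius at which the energy equation leaves no radial velocity. *)
have d2 u : u \in I -> derive1 rho u ^+ 2 = r1 ^+ 2 * (rho u - R1) / (rho u + n).
  move=> uI; have e := eE u uI.
  have -> : r1 ^+ 2 * (rho u - R1) = r1 ^+ 2 * (rho u - n) - 2 * tau0 ^+ 2 * n.
    by rewrite /R1; field.
  rewrite -{}e /grr; field.
  by rewrite rmn// gt_eqF// rpn.
(* t is a left inverse of rho on I, and a continuous injection of an interval
   is monotone. *)
have inj : {in I &, injective rho}.
  by move=> x y xI yI xy; rewrite -(tc x xI) -(tc y yI); congr t.
have mono : strictly_monotone I rho.
  apply: itv_continuous_inj_mono inj.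
  by apply: derivable_within_continuous => u; exact: drv.
have [|eps epsE drE] :=
  radial_speed_sign s0I s1I s01 r10 (drv irad) mono _ d2.
  by move=> u uI; split; [exact: rR1|exact: rpn].
have eps2 : eps ^+ 2 = 1 by case: epsE => ->; rewrite ?sqrrN expr1n.
exists eps; split => // s sI r ->{r}.
have quad f (G dG : R -> R) k l : (forall u, u \in I -> derivable f u 1) ->
    (forall r, R1 < r -> is_derive r 1 G (dG r)) -> {for R1, continuous G} ->
    G R1 = 0 ->
    (forall u, u \in I -> R1 < rho u ->
      derive1 f u = k * dG (rho u) * derive1 rho u) ->
    f (t r) @[r --> R1^'+] --> l -> f s = l + k * G (rho s).
  move=> df DG cG G0 fE fl.
  have := @quadrature R I rho f (fun r => k * G r) (fun r => k * dG r) t R1 l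
    s0 s1 s0I s1I s01 (drv irad) df mono rR1 _ _ fE near_t fl s sI.
  rewrite G0 mulr0 subr0; apply.
    move=> r rR; apply: is_derive_eq (is_deriveZ k (DG r rR)) _.
    by rewrite /GRing.scale.
  by apply: cvgMr.
have ab u : u \in I -> R1 < rho u ->
    (Num.sqrt (rho u - R1) != 0) && (Num.sqrt (rho u + n) != 0).
  by move=> uI uR; rewrite !gt_eqF// sqrtr_gt0 ?subr_gt0// rpn.
split.
  rewrite tc//; apply: (quad id _ _ (eps / r1) t1 _ (is_derive_prim_t n0 nR1)) t1l.
  - by move=> u _; exact: derivable_id.
  - exact: continuous_prim_t.
  - exact: prim_t_R1.
  move=> u uI uR; have /andP[a0 b0] := ab u uI uR.
  (* Writing 1 as eps^2 makes the identity hold for both signs at once. *)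
  rewrite drE// derive1E derive_id -eps2; field.
  by rewrite r10 a0 b0.
have tau1l' : ta (t r) @[r --> R1^'+] --> tau1.
  apply: cvg_trans tau1l; apply: near_eq_cvg; near=> r.
  have [tI tr] : t r \in I /\ rho (t r) = r by near: r.
  by have := tauc _ tI; rewrite -[c _ 0 irad]/(rho _) tr => ->.
rewrite tauc//.
apply: (quad ta _ _ (eps * tau0 / r1) tau1 _ (is_derive_prim_tau n0 nR1)) tau1l'.
- by move=> u; exact: drv.
- exact: continuous_prim_tau.
- exact: prim_tau_R1.
move=> u uI uR; have /andP[a0 b0] := ab u uI uR.
rewrite drE// dtaE//.
have -> : (rho u + n) / (rho u - n) * tau0 =
  eps ^+ 2 * ((rho u + n) / (rho u - n) * tau0) by rewrite eps2 mul1r.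
field.
by rewrite r10 a0 b0 rmn.
Unshelve. all: by end_near. Qed.
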